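(* Let $(G,m,w)$ be a weighted finite graph. Then, for $i=1,2,\dots,|V|$, $$\mu_i\le\min\left\{\operatorname{Deg}_S^{(|S^c|-j)}\ \Big|\ S\subset V,\ 0\le j\le|S^c|-i,\ \pi_0(G-S)\ge i+j\right\}.$$ In particular, for $i=1,2,\dots,|V|$, $$\mu_i\le\min\left\{\max_{x\in S^c}\operatorname{Deg}_S(x)\ \Big|\ S\subset V\text{ such that }\pi_0(G-S)\ge i\right\}.$$ Especially, if $G$ is equipped with the unit weight ($m\equiv1$ and $w\equiv1$), then $$\mu_i\le\min\left\{|S|\ \big|\ S\subset V\text{ such that }\pi_0(G-S)\ge i\right\}$$ for $i=1,2,\dots,|V|$. Here $\pi_0(G-S)$ is the number of connected components of $G-S$ (the graph obtained by deleting the vertices of $S$), and $\operatorname{Deg}_S^{(1)}\le\operatorname{Deg}_S^{(2)}\le\dots\le\operatorname{Deg}_S^{(|S^c|)}$ is the nondecreasing rearrangement of the values $\operatorname{Deg}_S(x)$, $x\in S^c$.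
   Context: A weighted finite graph $(G,m,w)$ is a finite simple graph $G$ with vertex set $V$ and edge set $E$, a vertex-measure $m:V\to(0,\infty)$ and an edge-weight $w:E\to(0,\infty)$; $w$ is extended to a symmetric function on $V\times V$ by $w_{xy}=0$ when $\{x,y\}\notin E$. $S^c=V\setminus S$. For $x\in S^c$, $\operatorname{Deg}_S(x)=\frac1{m_x}\sum_{y\in S}w_{xy}$. Laplacian: $\Delta u(x)=\frac1{m_x}\sum_{y\in V}(u(x)-u(y))w_{xy}$ for real functions $u$ on $V$; it is nonnegative and self-adjoint for $\langle u,v\rangle=\sum_{x\in V}u(x)v(x)m_x$, and its eigenvalues, counted with multiplicity, are $0=\mu_1\le\mu_2\le\dots\le\mu_{|V|}$. The minimum over an empty set is understood as $+\infty$; $j$ is an integer. *)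

(* Defs.v *)
From mathcomp Require Import all_boot all_order all_algebra.
From mathcomp Require Import polyrcf.
From mathcomp Require Import reals constructive_ereal.

Set Implicit Arguments.
Unset Strict Implicit.
Unset Printing Implicit Defensive.

Import Order.TTheory GRing.Theory Num.Theory.

Local Open Scope ring_scope.

(* The edge weight is given directly as its symmetric extension by 0 to all
   pairs of vertices. *)
Record wgraph (R : realType) (V : finType) := WGraph {
  adj : rel V;
  adj_sym : symmetric adj;
  adj_irr : irreflexive adj;
  meas : V -> R;
  meas_gt0 : forall x, 0 < meas x;
  wgt : V -> V -> R;
  wgt_sym : forall x y, wgt x y = wgt y x;
  wgt_gt0 : forall x y, adj x y -> 0 < wgt x y;
  wgt_eq0 : forall x y, ~~ adj x y -> wgt x y = 0
}.

Section WeightedGraph.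
Variables (R : realType) (V : finType) (g : wgraph R V).
Implicit Types (S : {set V}) (x y : V).

Definition laplacian (u : V -> R) x : R :=
  (meas g x)^-1 * \sum_y (u x - u y) * wgt g x y.

(* Matrix of the Laplacian in the coordinates given by [enum V]; it acts on row
   vectors by right multiplication, which is the convention of [eigenspace]. *)
Definition laplacian_mx : 'M[R]_#|V| :=
  lin1_mx (fun v : 'rV[R]_#|V| =>
    \row_i laplacian (fun x => v 0 (enum_rank x)) (enum_val i)).

Lemma mul_laplacian_mx (v : 'rV[R]_#|V|) :
  v *m laplacian_mx =
  \row_i laplacian (fun x => v 0 (enum_rank x)) (enum_val i).
Proof.
apply/rowP => i; rewrite !mxE [v in RHS]row_sum_delta /laplacian.
under eq_bigr do rewrite !mxE mulrCA mulr_sumr.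
rewrite -mulr_sumr exchange_big /=; congr (_ * _); apply: eq_bigr => y _.
rewrite !summxE -sumrB mulr_suml; apply: eq_bigr => j _.
by rewrite !mxE mulrA mulrBr.
Qed.

(* The eigenvalues of the Laplacian in nondecreasing order, each repeated as
   many times as the dimension of its eigenspace. *)
Definition spectrum : seq R :=
  sort <=%R (flatten [seq nseq (\rank (eigenspace laplacian_mx a)) a
                     | a <- rootsR (char_poly laplacian_mx)]).

Lemma count_spectrum (a : R) :
  count_mem a spectrum = \rank (eigenspace laplacian_mx a).
Proof.
rewrite /spectrum count_sort count_flatten -map_comp.
set p := char_poly _; have p0 : p != 0 by rewrite monic_neq0 ?char_poly_monic.
have Us : uniq (rootsR p) by exact: uniq_roots.
have [ain|anin] := boolP (a \in rootsR p).
  rewrite sumnE big_map (bigD1_seq a) //= count_nseq /= eqxx mul1n big1 ?addn0 //.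
  by move=> b ba; rewrite /= count_nseq /= (negbTE ba).
rewrite sumnE big_map big_seq big1 => [|b bin]; last first.
  by rewrite /= count_nseq /=; case: eqP => // ba; rewrite -ba bin in anin.
apply/esym/eqP; rewrite mxrank_eq0; apply: contraNT anin => ev.
have : root p a by rewrite -eigenvalue_root_char.
by have := roots_on_rootsR p0 a; rewrite !inE /= => <-.
Qed.

(* 1-based: mu 1 <= ... <= mu #|V|. *)
Definition mu (i : nat) : R := nth 0 spectrum i.-1.

Definition Deg S x : R := (meas g x)^-1 * \sum_(y in S) wgt g x y.

(* The k-th smallest value (1-based) of [Deg S] on the complement of S. *)
Definition Deg_rank S (k : nat) : R :=
  nth 0 (sort <=%R [seq Deg S x | x in ~: S]) k.-1.

(* Number of connected components of the subgraph induced on ~: S. *)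
Definition pi0 S : nat :=
  n_comp [rel x y | [&& x \notin S, y \notin S & adj g x y]] (~: S).

Definition unit_weight : Prop :=
  (forall x, meas g x = 1) /\ (forall x y, adj g x y -> wgt g x y = 1).

End WeightedGraph.

(* Main.v *)
(* The matrix of the Laplacian is self-adjoint for a weighted inner product, so
   it is diagonalizable over R. Hence a subspace W of dimension at least i on
   which the Rayleigh quotient is at most D forces mu_i <= D: otherwise W would
   meet the sum of the eigenspaces with eigenvalue > D.
   For D = Deg_S^{(|S^c|-j)}, at most j vertices of S^c have Deg_S > D, so at
   least i components of G - S contain no such vertex; W is spanned by their
   indicator functions. A function u in W vanishes on S and is constant on
   components, hence Delta u = Deg_S u wherever u does not vanish. *)

Require Import Defs.
From mathcomp Require Import all_boot all_order all_algebra.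
From mathcomp Require Import reals constructive_ereal.
From mathcomp Require Import complex.

Set Implicit Arguments.
Unset Strict Implicit.
Unset Printing Implicit Defensive.

Import Order.TTheory GRing.Theory Num.Theory.

Local Open Scope ring_scope.

(** * Diagonalization of self-adjoint matrices *)

(** Over [R[i]] the matrix is Hermitian, so the spectral theorem diagonalizes it with real
    eigenvalues. Diagonalizability is read off from the minimal polynomial, which extension of
    scalars preserves, so it descends to [R]. *)
Lemma symmetric_diagonalizable (R : rcfType) n (A : 'M[R]_n) :
  A^T = A -> diagonalizable A.
Proof.
case: n A => [|n] A symA.
  exists 1%:M; first exact: unitmx1.
  by apply/is_diag_mxP => -[].
pose f := real_complex R.
have [P [d [Pu dreal AE]]] : exists P d,
    [/\ P \in unitmx, d \is a mxOver Num.real &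
        map_mx f A = conjmx (invmx P) (diag_mx d)].
  have Aherm : map_mx f A \is hermsymmx.
    apply: realsym_hermsym.
      apply/is_hermitianmxP; rewrite expr0 scale1r.
      by apply/matrixP => i j; rewrite !mxE -[in RHS]symA mxE.
    by apply/mxOverP => i j; rewrite mxE; apply/complex_realP; exists (A i j).
  exists (spectralmx (map_mx f A)), (spectral_diag (map_mx f A)).
  split; [exact: spectral_unit|exact: hermitian_spectral_diag_real|].
  rewrite conjVmx ?spectral_unit //.
  exact/orthomx_spectralP/hermitian_normalmx.
pose d' : 'rV[R]_n.+1 := map_mx (@complex.Re R) d.
have dE : d = map_mx f d'.
  by apply/matrixP => i j; rewrite !mxE [RHS]RRe_real //; exact: (mxOverP dreal).
have minE : mxminpoly A = mxminpoly (diag_mx d').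
  apply: (map_poly_inj f).
  have -> : map_poly f (mxminpoly A) = mxminpoly (map_mx f A).
    by rewrite mxminpoly_map.
  have -> : map_poly f (mxminpoly (diag_mx d')) = mxminpoly (map_mx f (diag_mx d')).
    by rewrite mxminpoly_map.
  rewrite AE map_diag_mx -dE.
  by apply: mxminpoly_uconj; rewrite unitmx_inv.
by apply/diagonalizableP; rewrite minE; apply/diagonalizableP/diagonalizable_diag.
Qed.

(** With [K] the square root of [diag_mx m], the conjugate [K^-1 A K] equals [K^-1 (A K^2) K^-1],
    which is symmetric. *)
Lemma weighted_symmetric_diagonalizable (R : rcfType) n (A : 'M[R]_n)
    (m : 'rV[R]_n) :
  (forall i, 0 < m 0 i) -> (A *m diag_mx m)^T = A *m diag_mx m ->
  diagonalizable A.
Proof.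
move=> m_gt0 symA.
pose K := diag_mx (map_mx Num.sqrt m).
have KK : K *m K = diag_mx m.
  rewrite mulmx_diag; congr diag_mx; apply/rowP => i; rewrite !mxE.
  by rewrite -expr2 sqr_sqrtr // ltW.
have Ku : K \in unitmx.
  rewrite unitmxE det_diag unitfE; apply/prodf_neq0 => i _.
  by rewrite mxE gt_eqF // sqrtr_gt0.
have KT : K^T = K by rewrite tr_diag_mx.
have [|P Pu /diagonalizable_forPex[D /(simmxP Pu) PD]] :=
    @symmetric_diagonalizable R n (invmx K *m A *m K).
  have -> : invmx K *m A *m K = invmx K *m (A *m diag_mx m) *m invmx K.
    by rewrite -KK !mulmxA mulmxK.
  by rewrite !trmx_mul trmx_inv KT -trmx_mul symA !mulmxA.
have PKu : P *m invmx K \in unitmx by rewrite unitmx_mul Pu unitmx_inv.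
exists (P *m invmx K) => //; apply/diagonalizable_forPex; exists D.
apply/(simmxP PKu); rewrite [RHS]mulmxA -PD !mulmxA.
by rewrite mulmxK.
Qed.

(** * Eigenspaces and Rayleigh quotients *)

(** The identity [A *m M = M *m A^T] moves [A] from one argument of the form [u *m M *m v^T] to the
    other, turning the factor [a] into [b]. *)
Lemma eigenspace_orthogonal (F : fieldType) n (A M : 'M[F]_n) a b
    (u v : 'rV[F]_n) :
  A *m M = M *m A^T -> a != b ->
  (u <= eigenspace A a)%MS -> (v <= eigenspace A b)%MS -> u *m M *m v^T = 0.
Proof.
move=> AM ab /eigenspaceP uA /eigenspaceP vA.
have /eqP : a *: (u *m M *m v^T) = b *: (u *m M *m v^T).
  rewrite !(scalemxAl a) -uA -[u *m A *m M]mulmxA AM.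
  by rewrite [RHS]scalemxAr -linearZ /= -vA trmx_mul !mulmxA.
by rewrite -subr_eq0 -scalerBl scaler_eq0 subr_eq0 (negbTE ab) => /eqP.
Qed.

(** One half of the Courant-Fischer principle: [W] is too large to avoid the sum [U] of the
    eigenspaces above [D], and on nonzero vectors of [U] the Rayleigh quotient exceeds [D]. *)
Lemma rayleigh_gt (R : realFieldType) n k (A M : 'M[R]_n) (W : 'M[R]_(k, n))
    (rs : seq R) (D : R) :
    (forall u : 'rV_n, u != 0 -> 0 < (u *m M *m u^T) 0 0) ->
    A *m M = M *m A^T -> uniq rs ->
    (\sum_(r <- rs) eigenspace A r :=: 1%:M)%MS ->
    (\sum_(r <- rs | (r <= D)%R) \rank (eigenspace A r) < \rank W)%N ->
  exists2 u : 'rV_n, (u <= W)%MS &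
    D * (u *m M *m u^T) 0 0 < (u *m A *m M *m u^T) 0 0.
Proof.
move=> Mpos AM Urs rs1 rkW.
pose E i := eigenspace A rs`_i.
pose hi (i : 'I_(size rs)) := D < rs`_i.
pose U := (\sum_(i < size rs | hi i) E i)%MS.
pose U' := (\sum_(i < size rs | ~~ hi i) E i)%MS.
have UU' : (n <= \rank U + \rank U')%N.
  have [le_rk _] := mxrank_adds_leqif U U'; apply: leq_trans le_rk.
  rewrite -[X in (X <= _)%N](mxrank1 R n) -rs1; apply: mxrankS.
  rewrite (big_nth 0) big_mkord; apply/sumsmx_subP => i _.
  have [Di|Di] := boolP (hi i).
    by apply: submx_trans (addsmxSl _ _); apply: (sumsmx_sup i).
  by apply: submx_trans (addsmxSr _ _); apply: (sumsmx_sup i).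
have rkU' : (\rank U' < \rank W)%N.
  apply: leq_ltn_trans rkW; rewrite (big_nth 0) big_mkord.
  rewrite (eq_bigl (fun i : 'I_(size rs) => ~~ hi i)); last first.
    by move=> i; rewrite /hi -leNgt.
  apply: (big_ind2 (fun (X : 'M_n) (r : nat) => \rank X <= r)%N) => //.
    by rewrite mxrank0.
  move=> X r Y t Xr Yt; apply: leq_trans (leq_add Xr Yt).
  by have [] := mxrank_adds_leqif X Y.
(* Dimension count: [\rank W + \rank U] exceeds [\rank U' + \rank U], hence [n]. *)
have WU : (W :&: U != 0)%MS.
  rewrite -mxrank_eq0 -lt0n -(ltn_add2l (\rank (W + U)%MS)) addn0 mxrank_sum_cap.
  apply: leq_ltn_trans (rank_leq_col _) _.
  by apply: leq_ltn_trans UU' _; rewrite addnC ltn_add2r.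
have [u uWU u0] := rowV0Pn WU.
move: uWU; rewrite sub_capmx => /andP[uW /sub_sumsmxP[c uE]].
exists u => //.
pose v i := c i *m E i.
have vE i : (v i <= E i)%MS by exact: submxMl.
pose q (x y : 'rV[R]_n) := (x *m M *m y^T) 0 0.
have q_ge0 x : 0 <= q x x.
  have [->|/Mpos/ltW //] := eqVneq x 0.
  by rewrite /q !mul0mx mxE.
(* Only the diagonal term survives, by orthogonality of distinct eigenspaces. *)
have qvu i : hi i -> q (v i) u = q (v i) (v i).
  move=> Di; rewrite /q [in LHS]uE linear_sum mulmx_sumr summxE (bigD1 i) //=.
  rewrite big1 ?addr0 // => j /andP[_ ji].
  rewrite (eigenspace_orthogonal AM _ (vE i) (vE j)) ?mxE //.
  by rewrite nth_uniq // eq_sym.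
have quu : (u *m M *m u^T) 0 0 = \sum_(i < size rs | hi i) q (v i) (v i).
  rewrite [X in X *m M]uE 2!mulmx_suml summxE.
  by apply: eq_bigr => i Di; rewrite -qvu.
have quAu : (u *m A *m M *m u^T) 0 0 =
    \sum_(i < size rs | hi i) rs`_i * q (v i) (v i).
  rewrite [X in X *m A]uE 3!mulmx_suml summxE; apply: eq_bigr => i Di.
  rewrite -qvu // -/(v i); have /eigenspaceP -> := vE i.
  by rewrite -!scalemxAl mxE.
rewrite quAu -subr_gt0 quu mulr_sumr -sumrB.
under eq_bigr do rewrite -mulrBl.
(* All terms of the difference are nonnegative; one is positive, since [q u u > 0] forces some
   [q (v i) (v i)] to be nonzero. *)
have ge0 i : hi i -> 0 <= (rs`_i - D) * q (v i) (v i).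
  by move=> Di; rewrite mulr_ge0 // subr_ge0 ltW.
rewrite lt_neqAle sumr_ge0 // andbT eq_sym psumr_neq0 //.
have := Mpos u u0; rewrite quu lt_neqAle eq_sym psumr_neq0 // => /andP[].
move=> /hasP[i i_in /andP[Di qi]] _.
by apply/hasP; exists i => //; rewrite Di mulr_gt0 // subr_gt0.
Qed.

(** * Counting in sorted sequences *)

Lemma count_le_lt_nth (d : Order.disp_t) (T : orderType d) (x0 x : T) (s : seq T) i :
  sorted <=%O s -> (i < size s)%N -> (x < nth x0 s i)%O ->
  (count (<= x)%O s <= i)%N.
Proof.
move=> s_sorted i_lt x_lt.
rewrite -[s in (count _ s)](cat_take_drop i) count_cat.
have -> : count (<= x)%O (drop i s) = 0%N.
  apply/eqP; rewrite -leqn0 leqNgt -has_count; apply/hasPn => y.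
  move=> /(nthP x0)[j]; rewrite size_drop nth_drop => j_lt <- /=.
  rewrite -ltNge; apply: lt_le_trans x_lt _.
  by apply: le_sorted_leq_nth; rewrite ?inE ?leq_addr // -ltn_subRL.
by rewrite addn0 (leq_trans (count_size _ _)) // size_takel // ltnW.
Qed.

Lemma count_gt_nth (d : Order.disp_t) (T : orderType d) (x0 : T) (s : seq T) i :
  sorted <=%O s -> (i < size s)%N ->
  (count (> nth x0 s i)%O s <= size s - i.+1)%N.
Proof.
move=> s_sorted i_lt.
rewrite -[s in (count _ s)](cat_take_drop i.+1) count_cat.
have -> : count (> nth x0 s i)%O (take i.+1 s) = 0%N.
  apply/eqP; rewrite -leqn0 leqNgt -has_count; apply/hasPn => y.
  move=> /(nthP x0)[j]; rewrite size_takel // => j_lt <- /=.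
  rewrite -leNgt nth_take //; apply: le_sorted_leq_nth => //.
  by rewrite inE (leq_trans j_lt).
by rewrite add0n (leq_trans (count_size _ _)) // size_drop.
Qed.

(** Each entry of [s] equals at most one of the distinct members of [rs]. This bounds a total of
    multiplicities by a count in the spectrum. *)
Lemma sum_count_mem_le (T : eqType) (a : pred T) (rs s : seq T) :
  uniq rs -> (\sum_(r <- rs | a r) count_mem r s <= count a s)%N.
Proof.
elim: s => [|x s IH] Urs /=; first by rewrite big1.
rewrite big_split leq_add ?IH //=.
have [/allP xrs|/allPn[y y_rs /negPn/eqP xy]] := boolP (all (fun r => x != r) rs).
  by rewrite big_seq_cond big1 // => r /andP[/xrs/negbTE ->].
rewrite -{}xy in y_rs.
rewrite -big_filter; have [ax|/negbTE nax] := boolP (a x).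
  rewrite (bigD1_seq x) ?filter_uniq ?mem_filter ?ax //= eqxx big1 ?addn0 // => r.
  by rewrite eq_sym => /negbTE ->.
rewrite big_filter big1 // => r ar; case: eqVneq => // xr.
by rewrite xr ar in nax.
Qed.

(** * The Laplacian for the weighted inner product *)

Section Graph.
Variables (R : realType) (V : finType) (g : wgraph R V).
Implicit Types (S : {set V}) (x y : V) (u v : V -> R) (D : R).

(** The diagonal of the Gram matrix of the inner product weighted by [meas]. *)
Definition mass_row : 'rV[R]_#|V| := \row_i meas g (enum_val i).

Definition fun_of_row (v : 'rV[R]_#|V|) x : R := v 0 (enum_rank x).

Lemma mass_formE (v w : 'rV[R]_#|V|) :
  (v *m diag_mx mass_row *m w^T) 0 0 =
  \sum_x fun_of_row v x * meas g x * fun_of_row w x.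
Proof.
rewrite mxE (reindex (@enum_rank V)) /=; last exact: onW_bij (enum_rank_bij V).
by apply: eq_bigr => x _; rewrite mul_mx_diag !mxE enum_rankK.
Qed.

Lemma fun_of_row_laplacian (v : 'rV[R]_#|V|) x :
  fun_of_row (v *m laplacian_mx g) x = laplacian g (fun_of_row v) x.
Proof. by rewrite mul_laplacian_mx /fun_of_row mxE enum_rankK. Qed.

(** The measure cancels the factor in [laplacian]; what remains is symmetric in [u] and [v] after
    exchanging the sums, because [wgt] is symmetric. *)
Lemma laplacian_sym u v :
  \sum_x laplacian g u x * meas g x * v x = \sum_x u x * meas g x * laplacian g v x.
Proof.
have E (u' v' : V -> R) : \sum_x laplacian g u' x * meas g x * v' x =
    \sum_x \sum_y u' x * v' x * wgt g x y - \sum_x \sum_y u' y * v' x * wgt g x y.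
  rewrite -sumrB; apply: eq_bigr => x _; rewrite /laplacian.
  rewrite [_^-1 * _]mulrC divfK ?gt_eqF ?meas_gt0 // mulr_suml -sumrB.
  by apply: eq_bigr => y _; rewrite mulrAC mulrBl mulrBl.
rewrite E; under [RHS]eq_bigr do rewrite -mulrA mulrC [meas _ _ * _]mulrC.
rewrite E; congr (_ - _).
  by apply: eq_bigr => x _; apply: eq_bigr => y _; rewrite [v x * _]mulrC.
rewrite exchange_big; apply: eq_bigr => x _; apply: eq_bigr => y _.
by rewrite [u x * _]mulrC wgt_sym.
Qed.

Lemma laplacian_mx_sym :
  (laplacian_mx g *m diag_mx mass_row)^T = laplacian_mx g *m diag_mx mass_row.
Proof.
apply/matrixP => i j; rewrite mxE.
(* Entries are values of the weighted form on [Delta e_k] and [e_l], which reduces the claim to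
   self-adjointness on functions. *)
have entry k l : (laplacian_mx g *m diag_mx mass_row) k l =
    ((delta_mx 0 k : 'rV_#|V|) *m laplacian_mx g *m diag_mx mass_row *m
     (delta_mx 0 l : 'rV_#|V|)^T) 0 0.
  by rewrite trmx_delta -colE -!mulmxA -rowE [RHS]mxE [RHS]mxE.
rewrite !entry !mass_formE.
under eq_bigr do rewrite fun_of_row_laplacian.
under [RHS]eq_bigr do rewrite fun_of_row_laplacian.
rewrite laplacian_sym; apply: eq_bigr => x _.
by rewrite mulrC [_ * meas _ _]mulrC mulrA.
Qed.

Lemma mass_form_gt0 (v : 'rV[R]_#|V|) :
  v != 0 -> 0 < (v *m diag_mx mass_row *m v^T) 0 0.
Proof.
move=> v0; rewrite mass_formE lt_neqAle eq_sym.
have ge0 x : 0 <= fun_of_row v x * meas g x * fun_of_row v x.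
  by rewrite mulrAC mulr_ge0 ?sqr_ge0 // ltW ?meas_gt0.
rewrite sumr_ge0 // andbT psumr_neq0 //.
have /rV0Pn[i vi] := v0; apply/hasP; exists (enum_val i).
  by rewrite mem_index_enum.
rewrite lt_neqAle ge0 andbT eq_sym /fun_of_row enum_valK !mulf_neq0 //.
by rewrite gt_eqF ?meas_gt0.
Qed.

(** If [D < mu g i], fewer than [i] eigenvalues, with multiplicity, are at most [D], so [W] contains
    a vector with Rayleigh quotient above [D]. *)
Lemma mu_le_rayleigh k (W : 'M[R]_(k, #|V|)) i D : (0 < i)%N -> (i <= \rank W)%N ->
  (forall v : 'rV_#|V|, (v <= W)%MS ->
    \sum_x laplacian g (fun_of_row v) x * meas g x * fun_of_row v x <=
    D * \sum_x fun_of_row v x * meas g x * fun_of_row v x) ->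
  mu g i <= D.
Proof.
move=> i_gt0 iW WD; rewrite leNgt; apply/negP => D_mu.
have D_count : (count (<= D)%O (spectrum g) < i)%N.
  (* Past the end of [spectrum], [mu] is the default 0, but then the length of the list already
     bounds the count. *)
  have [i_lt|i_ge] := ltnP i.-1 (size (spectrum g)); last first.
    by rewrite -(prednK i_gt0) ltnS (leq_trans (count_size _ _)).
  rewrite -(prednK i_gt0) ltnS; apply: count_le_lt_nth D_mu => //.
  exact/sort_sorted/le_total.
have m_gt0 j : 0 < mass_row 0 j by rewrite mxE meas_gt0.
have /diagonalizablePeigen[rs Urs rs1] :=
  weighted_symmetric_diagonalizable m_gt0 laplacian_mx_sym.
have [|//|u uW] :=
  @rayleigh_gt _ _ _ _ (diag_mx mass_row) W rs D mass_form_gt0 _ Urs rs1.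
- by rewrite -laplacian_mx_sym trmx_mul tr_diag_mx.
- apply: leq_ltn_trans (leq_trans D_count iW).
  under eq_bigr do rewrite -count_spectrum.
  exact: sum_count_mem_le.
rewrite !mass_formE; under [X in _ < X]eq_bigr do rewrite fun_of_row_laplacian.
by rewrite ltNge WD.
Qed.

(** * Test functions supported on components *)

(** For [x] outside [S], neighbours outside [S] cancel and those in [S] contribute [u x] times their
    weight, so the Laplacian multiplies [u x] by [Deg g S x]. *)
Lemma laplacian_le_Deg S D u x :
    (forall y, y \in S -> u y = 0) ->
    (forall y, x \notin S -> y \notin S -> adj g x y -> u x = u y) ->
    (x \notin S -> u x != 0 -> Deg g S x <= D) ->
  laplacian g u x * meas g x * u x <= D * (u x * meas g x * u x).
Proof.
move=> uS uadj uD; have [->|ux0] := eqVneq (u x) 0; first by rewrite !mulr0.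
have xS : x \notin S by apply: contra_neqN ux0 => /uS.
have -> : laplacian g u x = u x * Deg g S x.
  rewrite /laplacian /Deg mulrCA; congr (_ * _).
  rewrite mulr_sumr [RHS]big_mkcond; apply: eq_bigr => y _.
  case: ifPn => [/uS ->|yS]; first by rewrite subr0.
  have [xy|/wgt_eq0 ->] := boolP (adj g x y); last by rewrite mulr0.
  by rewrite -uadj // subrr mul0r.
rewrite [u x * Deg _ _ _]mulrC -!(mulrA (Deg _ _ _)).
apply: ler_wpM2r; last exact: uD.
by rewrite mulrAC mulr_ge0 ?sqr_ge0 // ltW ?meas_gt0.
Qed.

Lemma mu_le_components S i j D : (0 < i)%N -> (i + j <= pi0 g S)%N ->
  (#|[set x in ~: S | (D < Deg g S x)%R]| <= j)%N -> mu g i <= D.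
Proof.
move=> i_gt0; rewrite /pi0; set e := (X in n_comp X _); set bad := finset _.
move=> ij_pi0 bad_j.
have e_sym : connect_sym e.
  apply: sym_connect_sym => x y; rewrite /e /= adj_sym.
  by case: (x \notin S); case: (y \notin S).
(* Components are represented by their roots; [T] keeps those without a bad vertex. At most [j] are
   discarded, so at least [i] remain. *)
pose T := [set r in ~: S | roots e r] :\: [set fingraph.root e x | x in bad].
have i_T : (i <= #|T|)%N.
  rewrite -(leq_add2r j) (leq_trans ij_pi0) //.
  have -> : n_comp e (~: S) = #|[set r in ~: S | roots e r]|.
    by apply: eq_card => x; rewrite !inE andbC.
  rewrite -(cardsID [set fingraph.root e x | x in bad]) addnC leq_add2l.
  apply: leq_trans bad_j; apply: leq_trans (leq_imset_card (fingraph.root e) _).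
  by rewrite subset_leq_card // subsetIr.
(* Row [t] is the indicator function of the component with root [t]. *)
pose W : 'M[R]_(#|T|, #|V|) := \matrix_(t < #|T|, l < #|V|)
  ((enum_val l \notin S) && (fingraph.root e (enum_val l) == enum_val t))%:R.
have rkW : \rank W = #|T|.
  apply/eqP/row_freeP.
  (* Evaluation at the roots is a right inverse, so the rows are independent. *)
  exists (\matrix_(l < #|V|, t < #|T|) (enum_val l == enum_val t)%:R).
  apply/matrixP => s t; rewrite !mxE (bigD1 (enum_rank (enum_val t))) //=.
  rewrite !mxE enum_rankK eqxx mulr1 big1 ?addr0 => [|l lt]; last first.
    rewrite !mxE [enum_val l == _]negbTE ?mulr0 //.
    by apply: contraNneq lt => <-; rewrite enum_valK.
  have := enum_valP t; rewrite !inE => /and3P[_ tS /eqP ->].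
  by rewrite tS /= eq_sym (inj_eq enum_val_inj).
apply: (@mu_le_rayleigh #|T| W); rewrite ?rkW // => v /submxP[a vE].
have uE x : fun_of_row v x =
    \sum_t a 0 t * ((x \notin S) && (fingraph.root e x == enum_val t))%:R.
  by rewrite /fun_of_row vE mxE; apply: eq_bigr => t _; rewrite mxE enum_rankK.
rewrite mulr_sumr; apply: ler_sum => x _.
apply: (laplacian_le_Deg (S := S)).
- by move=> y yS; rewrite uE big1 // => t _; rewrite yS mulr0.
- move=> y xS yS xy; rewrite !uE; apply: eq_bigr => t _.
  have /(fingraph.rootP e_sym) -> : connect e x y.
    by apply: connect1; rewrite /e /= xS yS.
  by rewrite xS yS.
(* A vertex with [Deg] above [D] is bad, so its root is not in [T] and every indicator vanishes
   there. *)
- move=> xS; apply: contra_neqT; rewrite -ltNge => D_lt.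
  rewrite uE big1 // => t _; rewrite xS /=; case: eqP => [xt|].
    have := enum_valP t; rewrite inE -xt => /andP[/imsetP[]].
    by exists x => //; rewrite !inE xS.
  by rewrite mulr0.
Qed.

(** The 1-based rank [#|~: S| - j] is the 0-based index [#|~: S| - j - 1], after which exactly [j]
    entries of the sorted list remain. *)
Lemma card_Deg_rank_lt S j : (j < #|~: S|)%N ->
  (#|[set x in ~: S | (Deg_rank g S (#|~: S| - j) < Deg g S x)%R]| <= j)%N.
Proof.
move=> jS; set D := Deg_rank _ _ _.
set s := sort <=%R [seq Deg g S x | x in ~: S].
have size_s : size s = #|~: S| by rewrite size_sort size_image.
have -> : #|[set x in ~: S | D < Deg g S x]| = count (> D)%O s.
  rewrite count_sort count_map -size_filter cardE /enum_mem -filter_predI.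
  by congr size; apply: eq_filter => x; rewrite !inE andbC.
have := @count_gt_nth _ _ 0 s (#|~: S| - j).-1.
rewrite size_s sort_sorted; last exact: le_total.
rewrite prednK ?subn_gt0 // leq_subr subKn ?(ltnW jS) //; exact.
Qed.

Lemma n_comp_le_card (e : rel V) (A : {set V}) : (n_comp e A <= #|A|)%N.
Proof. by apply/subset_leq_card/subsetP => x; rewrite inE => /andP[]. Qed.

(** This is the case [j = 0] with [D] the maximum of [Deg g S]: no vertex is bad. The maximum is
    attained because having a component makes [~: S] nonempty. *)
Lemma mu_le_max_Deg S i : (0 < i)%N -> (i <= pi0 g S)%N ->
  exists2 x, x \in ~: S & mu g i <= Deg g S x.
Proof.
move=> i_gt0 iS.
have /card_gt0P[x0 x0S] : (0 < #|~: S|)%N.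
  by rewrite (leq_trans i_gt0) // (leq_trans iS) // n_comp_le_card.
have [x xS x_max] := @arg_maxP _ _ _ x0 [pred x in ~: S] (Deg g S) x0S.
exists x => //; apply: (@mu_le_components S i 0); rewrite ?addn0 //.
rewrite leqn0 cards_eq0; apply/eqP/setP => y; rewrite !inE.
by apply/negP => /andP[yS]; rewrite ltNge => /negP[]; apply: x_max; rewrite !inE.
Qed.

Lemma unit_weight_Deg_le S x : unit_weight g -> Deg g S x <= #|S|%:R.
Proof.
case=> m1 w1; rewrite /Deg m1 invr1 mul1r -sumr_const; apply: ler_sum => y _.
by have [/w1 ->|/wgt_eq0 ->] := boolP (adj g x y).
Qed.

End Graph.

Theorem corollary1p5 (R : realType) (V : finType) (g : wgraph R V) (i : nat)
    (hi1 : (1 <= i)%N) (hiV : (i <= #|V|)%N) :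
  [/\ ((mu g i)%:E <=
        \big[mine/+oo]_(S : {set V})
        \big[mine/+oo]_(0 <= j < #|~: S|.+1
              | (i + j <= #|~: S|)%N && (i + j <= pi0 g S)%N)
          (Deg_rank g S (#|~: S| - j))%:E)%E,
      ((mu g i)%:E <=
        \big[mine/+oo]_(S : {set V} | (i <= pi0 g S)%N)
          \big[maxe/-oo]_(x in ~: S) (Deg g S x)%:E)%E
    & unit_weight g ->
      ((mu g i)%:E <=
        \big[mine/+oo]_(S : {set V} | (i <= pi0 g S)%N) (#|S|%:R)%:E)%E].
Proof.
split=> [||unit_g].
- apply: le_bigmin => [|S _]; first exact: leey.
  rewrite big_mkord; apply: le_bigmin => [|j /andP[ijS ij_pi0]]; first exact: leey.
  rewrite lee_fin; apply: (mu_le_components hi1 ij_pi0).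
  (* As [i >= 1], the bound [i + j <= #|~: S|] makes [j] strictly smaller than [#|~: S|]. *)
  by apply: card_Deg_rank_lt; apply: leq_trans ijS; rewrite -add1n leq_add2r.
- apply: le_bigmin => [|S iS]; first exact: leey.
  have [x xS mu_x] := mu_le_max_Deg hi1 iS.
  by apply: (bigmax_sup x) => //; rewrite lee_fin.
- apply: le_bigmin => [|S iS]; first exact: leey.
  have [x xS mu_x] := mu_le_max_Deg hi1 iS.
  by rewrite lee_fin (le_trans mu_x) // unit_weight_Deg_le.
Qed.
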